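(* Let $n\ge1$, $m\ge0$, $\underline Q=(Q_1,\dots,Q_m)\in(\mathbb K^* )^m$ and $\bullet\in\{\mathsf 0,\mathsf s,\mathsf{ss}\}$, and let $q\in\mathbb K^*$ with $q\ne\pm1$. Then $(q,\underline Q)$ is separate with respect to $\underline\mu$ for every $\underline\mu\in\mathscr P^{\bullet,m}_{n+1}$ if and only if $P^{(\bullet)}_n(q^2,\underline Q)\neq0$.
   Context: $\mathbb K$ is an algebraically closed field of characteristic $\ne2$, and $q+q^{-1}\ne0$. For $x\in\mathbb K^*$ put $\mathtt q(x)=2\frac{qx+(qx)^{-1}}{q+q^{-1}}$. $\mathscr P^{\mathsf 0,m}_n=\mathscr P^m_n$ is the set of $m$-multipartitions $(\lambda^{(1)},\dots,\lambda^{(m)})$ of $n$, with the convention $\mathscr P^0_n=\emptyset$ for $n\ge1$ (while $\mathscr P^0_0$ has one element, the empty tuple). $\mathscr P^{\mathsf s}_n$ is the set of strict partitions of $n$. $\mathscr P^{\mathsf s,m}_n=\bigcup_{a=0}^n\mathscr P^{\mathsf s}_a\times\mathscr P^m_{n-a}$, elements written $(\lambda^{(0)},\lambda^{(1)},\dots,\lambda^{(m)})$; $\mathscr P^{\mathsf{ss},m}_n=\bigcup_{a+b+c=n}\mathscr P^{\mathsf s}_a\times\mathscr P^{\mathsf s}_b\times\mathscr P^m_c$, elements written $(\lambda^{(0_-)},\lambda^{(0_+)},\lambda^{(1)},\dots,\lambda^{(m)})$. Partitions are identified with Young diagrams and strict partitions (components $0,0_\pm$) with shifted Young diagrams (row $i$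 starts in column $i$). $(i,j,l)$ is the box in row $i$, column $j$ of component $l$; $\mathrm{Std}(\underline\lambda)$ is the set of standard tableaux of shape $\underline\lambda$ (entries increase along rows and columns in each component). With $Q_0=Q_{0_+}=1$ and $Q_{0_-}=-1$, the residue of $(i,j,l)$ is $Q_lq^{2(j-i)}$, and $\mathrm{res}_{\mathfrak t}(k)$ is the residue of the box of $\mathfrak t$ containing $k$. For $\underline\lambda\in\mathscr P^{\bullet,m}_N$, $(q,\underline Q)$ is *separate* with respect to $\underline\lambda$ if for every $\mathfrak t\in\mathrm{Std}(\underline\lambda)$ and every $k=1,\dots,N-1$, $\mathtt q(\mathrm{res}_{\mathfrak t}(k))\neq\mathtt q(\mathrm{res}_{\mathfrak t}(k+1))$. $P^{(\mathsf 0)}_n(q^2,\underline Q)=\prod_{t=1}^n(q^{2t}-1)\cdot R$ and $P^{(\mathsf s)}_n(q^2,\underline Q)=P^{(\mathsf{ss})}_n(q^2,\underline Q)=\prod_{t=1}^n\big((q^{2t}-1)(q^{2t}+1)\big)\cdot R$, where $$R=\prod_{i=1}^m\Big(\prod_{t=3-n}^{n-1}(Q_i^2-q^{-2t})\prod_{t=1-n}^n(Q_i^2-q^{-4t})\Big)\prod_{1\le i<i'\le m}\Big(\prod_{t=1-n}^{n-1}(Q_i-Q_{i'}q^{-2t})(Q_iQ_{i'}-q^{-2(t+1)})\Big),$$ the product over $3-n\le t\le n-1$ being $1$ when $n=1$ (and $R=1$ when $m=0$).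
   Formalization: The case of bullet 0 with m = 0 and n ≥ 3 is excluded: there the set of multipartitions of n+1 is empty, so separateness holds vacuously, while the product of (q^{2t}-1) can vanish, e.g. n = 3 and q a primitive cube root of unity. *)

(* Defs.v *)
From mathcomp Require Import all_boot all_order all_algebra.

Set Implicit Arguments.
Unset Strict Implicit.
Unset Printing Implicit Defensive.

Import Order.TTheory GRing.Theory Num.Theory.
Local Open Scope ring_scope.

(* The three values of the superscript bullet: 0, s, ss. *)
Inductive kind := K0 | Ks | Kss.

Definition nshifted (b : kind) : nat :=
  match b with K0 => 0%N | Ks => 1%N | Kss => 2%N end.

(* Labels of components: [inr i] is the ordinary component i+1, while [inl]
   labels the shifted components: 0 for Ks, and 0_- (index 0), 0_+ (index 1)
   for Kss. *)
Definition comp (b : kind) (m : nat) : finType := ('I_(nshifted b) + 'I_m)%type.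

Definition mshape (b : kind) (m : nat) := {ffun comp b m -> seq nat}.

Definition is_part (s : seq nat) : bool := sorted geq s && (0%N \notin s).
Definition is_strict_part (s : seq nat) : bool :=
  sorted gtn s && (0%N \notin s).

Definition shape_size b m (la : mshape b m) : nat := (\sum_l sumn (la l))%N.

Definition multipart b m (N : nat) (la : mshape b m) : bool :=
  [&& [forall i, is_strict_part (la (inl i))],
      [forall i, is_part (la (inr i))] & shape_size la == N].

(* (row, column, component); rows and columns are numbered from 0, which does
   not change the content column - row. *)
Definition box (b : kind) (m : nat) := (nat * nat * comp b m)%type.

Definition in_shape b m (la : mshape b m) (x : box b m) : bool :=
  let: (i, j, l) := x in
  match l with
  | inl _ => (i <= j < i + nth 0 (la l) i)%N
  | inr _ => (j < nth 0 (la l) i)%N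
  end.

(* A tableau is a labelling t of all boxes, of which only the values on the
   diagram of la matter. *)
Definition standard b m (la : mshape b m) (t : box b m -> nat) : Prop :=
  [/\ forall x, in_shape la x -> (1 <= t x <= shape_size la)%N,
      forall x y, in_shape la x -> in_shape la y -> t x = t y -> x = y,
      forall k, (1 <= k <= shape_size la)%N ->
        exists2 x, in_shape la x & t x = k,
      forall i j j' l, in_shape la (i, j, l) -> in_shape la (i, j', l) ->
        (j < j')%N -> (t (i, j, l) < t (i, j', l))%N
    & forall i i' j l, in_shape la (i, j, l) -> in_shape la (i', j, l) ->
        (i < i')%N -> (t (i, j, l) < t (i', j, l))%N].

Section Residues.
Variables (K : fieldType) (b : kind) (m : nat) (q : K) (Q : 'I_m -> K).

Definition qfun (x : K) : K := 2%:R * ((q * x + (q * x)^-1) / (q + q^-1)).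

Definition charge (l : comp b m) : K :=
  match l with
  | inl i => match b with
             | Kss => if i == 0%N :> nat then - 1 else 1
             | _ => 1
             end
  | inr i => Q i
  end.

Definition residue (x : box b m) : K :=
  let: (i, j, l) := x in charge l * q ^ (2 * (j%:Z - i%:Z)).

(* x and y are the boxes of t containing k and k.+1. *)
Definition separate (la : mshape b m) : Prop :=
  forall t, standard la t ->
  forall k, (1 <= k <= (shape_size la).-1)%N ->
  forall x y, in_shape la x -> in_shape la y -> t x = k -> t y = k.+1 ->
  qfun (residue x) != qfun (residue y).

End Residues.

(* The integers a, a+1, ..., c (none if c < a). *)
Definition zrange (a c : int) : seq int :=
  [seq a + k%:Z | k <- iota 0 (absz (Num.max (0 : int) (c - a + 1)))].

Section Poincare.
Variables (K : fieldType) (n m : nat) (q : K) (Q : 'I_m -> K).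

Definition Rfactor : K :=
  (\prod_(i < m)
     ((\prod_(t <- zrange (3 - n%:Z) (n%:Z - 1)) (Q i ^+ 2 - q ^ (- 2 * t))) *
      (\prod_(t <- zrange (1 - n%:Z) n%:Z) (Q i ^+ 2 - q ^ (- 4 * t))))) *
  (\prod_(i < m) \prod_(i' < m | (i < i')%N)
     \prod_(t <- zrange (1 - n%:Z) (n%:Z - 1))
       ((Q i - Q i' * q ^ (- 2 * t)) * (Q i * Q i' - q ^ (- 2 * (t + 1))))).

Definition Poincare (b : kind) : K :=
  match b with
  | K0 => \prod_(1 <= t < n.+1) (q ^+ (2 * t) - 1)
  | _ => \prod_(1 <= t < n.+1) ((q ^+ (2 * t) - 1) * (q ^+ (2 * t) + 1))
  end * Rfactor.

End Poincare.

(* Main.v *)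
Require Import Defs.
From mathcomp Require Import all_boot all_order all_algebra.
From mathcomp Require Import zify ring.

Set Implicit Arguments.
Unset Strict Implicit.
Unset Printing Implicit Defensive.

Import Order.TTheory GRing.Theory Num.Theory.
Local Open Scope ring_scope.

(* Since q(x) = q(y) iff x = y or q^2 x y = 1, for boxes of contents c, c' in
   components of charges a, a' the residues collide iff a = a' q^(2(c' - c)) or
   a a' = q^(-2(c + c' + 1)). Two boxes with consecutive entries of a standard
   tableau either lie in different components, or are adjacent, or are
   incomparable; in each case the number of boxes available bounds c' - c and
   c + c' + 1, and the collisions within these bounds are the zeros of the
   factors of P. For shifted components all of them amount to q^(4t) = 1 or
   Q_i^2 = q^(-4t). Conversely each zero is realised by a row, a column,
   a hook, or two lines in different components. *)

(** * Diagrams and consecutive boxes of a standard tableau *)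

Lemma nth_part p i i' : sorted geq p -> (i <= i')%N ->
  (nth 0 p i' <= nth 0 p i)%N.
Proof.
move=> sp le_ii'; have [lt_i'|le_i'] := ltnP i' (size p); last first.
  by rewrite [nth 0 p i']nth_default.
apply: (sorted_leq_nth (leT := geq)) => //; rewrite ?inE.
- by move=> a b c ab bc; apply: leq_trans bc ab.
- by move=> a; apply: leqnn.
- exact: leq_ltn_trans lt_i'.
Qed.

(** Each strict decrease of the row length offsets the unit shift of the row. Positivity keeps the
    induction inside the list, beyond which [nth] defaults to 0. *)
Lemma nth_strict_part p i i' : sorted gtn p -> (i <= i')%N ->
  (0 < nth 0 p i')%N -> (i' + nth 0 p i' <= i + nth 0 p i)%N.
Proof.
move=> sp le_ii'; rewrite -(subnKC le_ii').
elim: (i' - i)%N => [|d IHd]; first by rewrite addn0.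
rewrite addnS => pos.
have lt_s : ((i + d).+1 < size p)%N.
  by rewrite ltnNge; apply/negP => /(nth_default 0%N) E; rewrite E in pos.
have lt_p : (nth 0 p (i + d).+1 < nth 0 p (i + d))%N.
  apply: (sorted_ltn_nth (leT := gtn)) => //; rewrite ?inE //; last exact: ltnW.
  by move=> a b c ab bc; apply: ltn_trans bc ab.
by have := IHd (leq_ltn_trans (leq0n _) lt_p); lia.
Qed.

Lemma strict_part_is_part p : is_strict_part p -> is_part p.
Proof.
case/andP=> sp p0; rewrite /is_part p0 andbT.
by apply: sub_sorted sp => a b /ltnW.
Qed.

Lemma sum_nth_le_sumn p k : (\sum_(0 <= r < k) nth 0 p r <= sumn p)%N.
Proof.
elim: p k => [|a p IHp] k; first by rewrite big1 // => r _; rewrite nth_nil.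
case: k => [|k]; first by rewrite big_nil.
by rewrite big_nat_recl //= leq_add2l.
Qed.

(** Rows 0 to i' are at least as long as row i', and rows i'+1 to i at least as long as row i. This
    box count is the source of the content bounds within one component. *)
Lemma part_sumn_ge p i i' : is_part p -> (i' <= i)%N ->
  (i'.+1 * nth 0 p i' + (i - i') * nth 0 p i <= sumn p)%N.
Proof.
case/andP=> sp _ le_i'i; apply: leq_trans (sum_nth_le_sumn p i.+1).
rewrite (big_cat_nat (n := i'.+1)) //=.
have -> : (i - i' = i.+1 - i'.+1)%N by [].
rewrite -{1}[i'.+1]subn0 -!sum_nat_const_nat.
by apply: leq_add; rewrite big_nat_cond [leqRHS]big_nat_cond;
  apply: leq_sum => r; rewrite andbT => /andP[_ lt_r]; apply: nth_part.
Qed.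

Lemma incr_dist (f : nat -> nat) a c :
    (a <= c)%N -> (forall k, (a <= k < c)%N -> (f k < f k.+1)%N) ->
  (f a + (c - a) <= f c)%N.
Proof.
elim: c => [|c IHc] le_ac incr.
  by rewrite sub0n addn0; move: le_ac; rewrite leqn0 => /eqP->.
have [lt_ca|le_ac'] := ltnP c a.
  by have -> : a = c.+1; [lia | rewrite subnn addn0].
have := incr c ltac:(lia); have := IHc le_ac' (fun k kP => incr k ltac:(lia)).
by lia.
Qed.

Definition row_len b m (la : mshape b m) (l : Defs.comp b m) i :=
  nth 0%N (la l) i.
Definition comp_size b m (la : mshape b m) (l : Defs.comp b m) := sumn (la l).

Lemma in_shape_inl b m (la : mshape b m) i j l :
  in_shape la (i, j, inl l) = (i <= j < i + row_len la (inl l) i)%N.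
Proof. by []. Qed.

Lemma in_shape_inr b m (la : mshape b m) i j l :
  in_shape la (i, j, inr l) = (j < row_len la (inr l) i)%N.
Proof. by []. Qed.

Section Tableaux.
Variables (b : kind) (m N : nat) (la : mshape b m).
Hypothesis la_mp : multipart N la.

Lemma multipart_inl i : is_strict_part (la (inl i)).
Proof. by case/and3P: la_mp => /forallP. Qed.

Lemma multipart_inr i : is_part (la (inr i)).
Proof. by case/and3P: la_mp => _ /forallP. Qed.

Lemma multipart_is_part l : is_part (la l).
Proof.
by case: l => i; [apply/strict_part_is_part/multipart_inl|apply: multipart_inr].
Qed.

Lemma multipart_size : shape_size la = N.
Proof. by case/and3P: la_mp => _ _ /eqP. Qed.

Lemma row_len_le l r r' : (r <= r')%N -> (row_len la l r' <= row_len la l r)%N.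
Proof. by case/andP: (multipart_is_part l) => sp _; apply: nth_part. Qed.

Lemma row_len_inl i r r' : (r <= r')%N -> (0 < row_len la (inl i) r')%N ->
  (r' + row_len la (inl i) r' <= r + row_len la (inl i) r)%N.
Proof. by case/andP: (multipart_inl i) => sp _; apply: nth_strict_part. Qed.

Lemma rows_le_size l r r' : (r <= r')%N ->
  (r.+1 * row_len la l r + (r' - r) * row_len la l r' <= comp_size la l)%N.
Proof. exact/part_sumn_ge/multipart_is_part. Qed.

Lemma component_size_le l : (comp_size la l <= N)%N.
Proof.
by rewrite -multipart_size /shape_size (bigD1 l) //=; apply: leq_addr.
Qed.

Lemma component_size2_le l l' : l != l' ->
  (comp_size la l + comp_size la l' <= N)%N.
Proof.
move=> ne_ll'; rewrite -multipart_size /shape_size (bigD1 l) //= leq_add2l.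
by rewrite (bigD1 l') 1?eq_sym //=; apply: leq_addr.
Qed.

(** The path follows row i and then goes down column j'. In a shifted diagram the other corner (i',
    j) may lie below the diagonal. *)
Lemma in_shape_between i j i' j' k h l :
    in_shape la (i, j, l) -> in_shape la (i', j', l) ->
    (i <= k <= i')%N -> (j <= h <= j')%N -> k = i \/ h = j' ->
  in_shape la (k, h, l).
Proof.
case: l => l; rewrite ?in_shape_inl ?in_shape_inr => xP yP kP hP E.
  by have := @row_len_inl l k i'; lia.
by have := @row_len_le (inr l) k i'; lia.
Qed.

Variable t : box b m -> nat.
Hypothesis t_std : standard la t.

Lemma standard_dist i j i' j' l :
    in_shape la (i, j, l) -> in_shape la (i', j', l) ->
    (i <= i')%N -> (j <= j')%N ->
  (t (i, j, l) + (j' - j) + (i' - i) <= t (i', j', l))%N.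
Proof.
case: t_std => _ _ _ t_row t_col xP yP le_ii' le_jj'.
have rowP h : (j <= h <= j')%N -> in_shape la (i, h, l).
  by move=> hP; apply: (in_shape_between xP yP); [lia|lia|left].
have colP k : (i <= k <= i')%N -> in_shape la (k, j', l).
  by move=> kP; apply: (in_shape_between xP yP); [lia|lia|right].
have row_le : (t (i, j, l) + (j' - j) <= t (i, j', l))%N.
  apply: (incr_dist (f := fun h => t (i, h, l))) => // h hP.
  by apply: t_row; rewrite ?rowP //; lia.
apply: leq_trans (leq_add row_le (leqnn _)) _.
apply: (incr_dist (f := fun k => t (k, j', l))) => // k kP.
by apply: t_col; rewrite ?colP //; lia.
Qed.

(** By [standard_dist], comparable boxes with consecutive entries are at distance one, hence
    adjacent; otherwise they are incomparable. *)
Lemma standard_consecutive i j i' j' l :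
    in_shape la (i, j, l) -> in_shape la (i', j', l) ->
    t (i', j', l) = (t (i, j, l)).+1 ->
  [\/ i' = i /\ j' = j.+1, i' = i.+1 /\ j' = j, (i < i')%N /\ (j' < j)%N
    | (i' < i)%N /\ (j < j')%N].
Proof.
move=> xP yP txy.
have [le_ii'|lt_i'i] := leqP i i'; have [le_jj'|lt_j'j] := leqP j j'.
- have dist := standard_dist xP yP le_ii' le_jj'.
  have [lt_ii'|ge_ii'] := ltnP i i'; first by apply: Or42; lia.
  have [lt_jj'|ge_jj'] := ltnP j j'; first by apply: Or41; lia.
  have [Ei Ej] : i' = i /\ j' = j by lia.
  by rewrite Ei Ej in txy; lia.
- have [Ei|ne] := eqVneq i i'; last by apply: Or43; lia.
  by have := standard_dist yP xP; lia.
- have [Ej|ne] := eqVneq j j'; last by apply: Or44; lia.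
  by have := standard_dist yP xP; lia.
- by have := standard_dist yP xP; lia.
Qed.

Local Notation content i j := (j%:Z - i%:Z :> int).

Lemma content_inl_bound i j l : in_shape la (i, j, inl l) ->
  0 <= content i j < (comp_size la (inl l))%:Z.
Proof.
rewrite in_shape_inl => xP.
by have := @rows_le_size (inl l) i i (leqnn i); nia.
Qed.

Lemma content_inr_bound i j l : in_shape la (i, j, inr l) ->
  `|content i j| < (comp_size la (inr l))%:Z.
Proof.
rewrite in_shape_inr => xP.
by have := @rows_le_size (inr l) i i (leqnn i); nia.
Qed.

(** For adjacent boxes c + c' + 1 is twice the larger content; for incomparable ones it is less than
    the total length of their two rows. As the squared charge is 1, the two forms lead to q^(2s) = 1
    and q^(4s) = 1. *)
Lemma consecutive_inl i j i' j' l :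
    in_shape la (i, j, inl l) -> in_shape la (i', j', inl l) ->
    t (i', j', inl l) = (t (i, j, inl l)).+1 ->
  let c := content i j in let c' := content i' j' in
  0 < `|c' - c| < N%:Z /\
  (exists2 s, 0 < s < N%:Z & (c + c' + 1 = s \/ c + c' + 1 = 2 * s)).
Proof.
move=> xP yP txy c c'.
have := content_inl_bound xP; have := content_inl_bound yP.
have := component_size_le (inl l); rewrite -/c -/c'.
case: (standard_consecutive xP yP txy) => [] [E1 E2] szP c'P cP.
- by split; [lia | exists c'; [lia | right; lia]].
- by split; [lia | exists c; [lia | right; lia]].
- have := @rows_le_size (inl l) i i' (ltnW E1).
  move: xP yP; rewrite !in_shape_inl => xP yP szP'.
  by split; [lia | exists (c + c' + 1); [nia | left]].
- have := @rows_le_size (inl l) i' i (ltnW E1).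
  move: xP yP; rewrite !in_shape_inl => xP yP szP'.
  by split; [lia | exists (c + c' + 1); [nia | left]].
Qed.

(** For adjacent boxes s is again the larger content. For incomparable ones the lower box is not in
    row 0 and the upper one not in column 0, which narrows the range to that of the first product in
    R when N = n + 1. *)
Lemma consecutive_inr i j i' j' l :
    in_shape la (i, j, inr l) -> in_shape la (i', j', inr l) ->
    t (i', j', inr l) = (t (i, j, inr l)).+1 ->
  let c := content i j in let c' := content i' j' in
  0 < `|c' - c| < N%:Z /\
  (4 - N%:Z <= c + c' + 1 <= N%:Z - 2 \/
   exists2 s, 2 - N%:Z <= s < N%:Z & c + c' + 1 = 2 * s).
Proof.
move=> xP yP txy c c'.
have := content_inr_bound xP; have := content_inr_bound yP.
have := component_size_le (inr l); rewrite -/c -/c'.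
case: (standard_consecutive xP yP txy) => [] [E1 E2] szP c'P cP.
- by split; [lia | right; exists c'; lia].
- by split; [lia | right; exists c; lia].
- have := @rows_le_size (inr l) i i' (ltnW E1).
  move: xP yP; rewrite !in_shape_inr => xP yP szP'.
  by split; [nia | left; nia].
- have := @rows_le_size (inr l) i' i (ltnW E1).
  move: xP yP; rewrite !in_shape_inr => xP yP szP'.
  by split; [nia | left; nia].
Qed.
End Tableaux.

(** * The function q and the factors of P *)

Lemma mem_zrange (a c t : int) : (t \in zrange a c) = (a <= t <= c).
Proof.
apply/mapP/idP => [[k]|tP]; first by rewrite mem_iota => kP ->; lia.
by exists (absz (t - a)); [rewrite mem_iota|]; lia.
Qed.

Section Separation.
Variables (K : fieldType) (q : K).
Hypotheses (q_neq0 : q != 0) (qDV_neq0 : q + q^-1 != 0).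
Hypothesis charK : 2%N \notin [pchar K].

Lemma two_neq0 : 2%:R != 0 :> K.
Proof. by move: charK; rewrite inE. Qed.

(** The difference of the two values is (x - y)(q^2 x y - 1) times a scalar, which is nonzero
    because 2 and q + q^-1 are. *)
Lemma qfun_eq x y : x != 0 -> y != 0 ->
  (qfun q x == qfun q y) = (x == y) || (q ^+ 2 * x * y == 1).
Proof.
move=> x0 y0.
have -> : (qfun q x == qfun q y) = (qfun q x - qfun q y == 0).
  by rewrite subr_eq0.
have -> : qfun q x - qfun q y =
    2%:R / (q + q^-1) * ((q * x * y)^-1 * ((x - y) * (q ^+ 2 * x * y - 1))).
  have q2_neq0 : q * q + 1 != 0.
    rewrite (_ : q * q + 1 = q * (q + q^-1)) ?mulf_neq0 //.
    by rewrite mulrDr divff.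
  by rewrite /qfun; field; rewrite ?expr2 x0 y0 q_neq0 q2_neq0.
by rewrite !mulf_eq0 !invr_eq0 !mulf_eq0 (negPf two_neq0) (negPf qDV_neq0)
  (negPf q_neq0) (negPf x0) (negPf y0) /= !subr_eq0.
Qed.

Lemma qfun_shift_eq (a a' : K) (c c' : int) : a != 0 -> a' != 0 ->
  (qfun q (a * q ^ (2 * c)) == qfun q (a' * q ^ (2 * c'))) =
  (a == a' * q ^ (2 * (c' - c))) || (a * a' == q ^ (- 2 * (c + c' + 1))).
Proof.
move=> a0 a'0; have qz z : q ^ z != 0 by rewrite expfz_neq0.
rewrite qfun_eq ?mulf_neq0 //; congr (_ || _).
  rewrite -[RHS](inj_eq (mulIf (qz (2 * c)))) -mulrA -expfzDr //.
  by rewrite (_ : 2 * (c' - c) + 2 * c = 2 * c') //; ring.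
rewrite -[RHS](inj_eq (mulIf (qz (2 * (c + c' + 1))))) -expfzDr //.
rewrite (_ : - 2 * (c + c' + 1) + 2 * (c + c' + 1) = 0) ?expr0z; last by ring.
rewrite (_ : 2 * (c + c' + 1) = 2 + 2 * c + 2 * c'); last by ring.
by rewrite !expfzDr // -exprnP; congr (_ == _); ring.
Qed.


(** Such an e is its own inverse, so the sign of the exponent is immaterial. *)
Lemma exprz_even_eq (e : K) (z : int) : e ^+ 2 = 1 ->
  (q ^ (2 * z) == e) = (q ^+ (2 * `|z|) == e).
Proof.
move=> e2; have [k [->|->]] : exists k : nat, z = k \/ z = - k%:Z.
- by exists `|z|%N; lia.
- by rewrite absz_nat -PoszM -exprnP.
have eV : e^-1 = e.
  have e0 : e != 0.
    by apply: contra_eq_neq e2 => ->; rewrite expr0n eq_sym oner_eq0.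
  by rewrite -[LHS]mulr1 -e2 expr2 mulKf.
rewrite mulrN -invr_expz abszN absz_nat -PoszM -exprnP.
by rewrite -{1}eV (inj_eq invr_inj).
Qed.

End Separation.

Section Factors.
Variables (K : fieldType) (n m : nat) (q : K) (Q : 'I_m -> K).

Lemma Rfactor_neq0P :
  (Rfactor n q Q != 0) <->
  [/\ forall i (t : int), 3 - n%:Z <= t <= n%:Z - 1 ->
        Q i ^+ 2 != q ^ (- 2 * t),
      forall i (t : int), 1 - n%:Z <= t <= n%:Z -> Q i ^+ 2 != q ^ (- 4 * t)
    & forall (i i' : 'I_m) (t : int), (i < i')%N -> 1 - n%:Z <= t <= n%:Z - 1 ->
        (Q i != Q i' * q ^ (- 2 * t)) && (Q i * Q i' != q ^ (- 2 * (t + 1)))].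
Proof.
rewrite /Rfactor mulf_eq0 negb_or; split.
  case/andP=> /prodf_neq0 R1 /prodf_neq0 R2.
  split=> [i t tP|i t tP|i i' t ii' tP].
  - have:= R1 i isT; rewrite mulf_eq0 negb_or prodf_seq_neq0.
    case/andP=> /allP R _.
    by have := R t; rewrite mem_zrange subr_eq0 => /(_ tP).
  - have:= R1 i isT; rewrite mulf_eq0 negb_or => /andP[_].
    rewrite prodf_seq_neq0 => /allP R.
    by have := R t; rewrite mem_zrange subr_eq0 => /(_ tP).
  - have := R2 i isT => /prodf_neq0 /(_ i' ii').
    rewrite prodf_seq_neq0 => /allP R.
    by have := R t; rewrite mem_zrange mulf_eq0 negb_or !subr_eq0 => /(_ tP).
case=> R1 R2 R3; apply/andP; split; apply/prodf_neq0 => i _.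
  rewrite mulf_neq0 // prodf_seq_neq0; apply/allP => t;
    rewrite mem_zrange /= subr_eq0.
    exact: R1.
  exact: R2.
apply/prodf_neq0 => i' ii'; rewrite prodf_seq_neq0; apply/allP => t.
by rewrite mem_zrange /= mulf_eq0 negb_or !subr_eq0; apply: R3.
Qed.

Lemma Poincare_neq0P b :
  (Poincare n q Q b != 0) <->
  [/\ forall t, (0 < t <= n)%N -> q ^+ (2 * t) != 1,
      b <> K0 -> forall t, (0 < t <= n)%N -> q ^+ (2 * t) != - 1
    & Rfactor n q Q != 0].
Proof.
have seqP (F : nat -> K) : reflect (forall t, (0 < t <= n)%N -> F t != 0)
    (\prod_(1 <= t < n.+1) F t != 0).
  rewrite prodf_seq_neq0; apply: (iffP allP) => F_neq0 t.
    by move=> tP; apply: F_neq0; rewrite mem_index_iota.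
  by rewrite mem_index_iota; apply: F_neq0.
(* The factors q^(2t) - 1 are common to all kinds; splitting the shifted product isolates the
   factors q^(2t) + 1. *)
have -> : (Poincare n q Q b != 0) =
    (\prod_(1 <= t < n.+1) (q ^+ (2 * t) - 1) != 0) &&
    ((if b is K0 then true else
      \prod_(1 <= t < n.+1) (q ^+ (2 * t) + 1) != 0)) && (Rfactor n q Q != 0).
  by case: b; rewrite /Poincare ?big_split !mulf_eq0 !negb_or ?andbT.
split=> [/andP[/andP[/seqP P1 P2] R]|[P1 P2 R]].
  split=> // [t tP | b_neq0 t tP]; first by rewrite -subr_eq0 P1.
  by rewrite -subr_eq0 opprK; case: b P2 b_neq0 => // /seqP-> //.
rewrite R andbT; apply/andP; split.
  by apply/seqP => t tP; rewrite subr_eq0 P1.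
by case: b P2 => // P2; apply/seqP => t tP; rewrite -[1]opprK subr_eq0 P2.
Qed.
End Factors.

(** * Separation from nonvanishing *)

Section Separate.
Variables (K : fieldType) (q : K).
Hypotheses (q_neq0 : q != 0) (qDV_neq0 : q + q^-1 != 0).
Hypothesis charK : 2%N \notin [pchar K].
Variables (b : kind) (n m : nat) (Q : 'I_m -> K).
Hypothesis Q_neq0 : forall i, Q i != 0.

Lemma charge_inl_sqr i : charge Q (inl i : Defs.comp b m) ^+ 2 = 1.
Proof.
rewrite /=; case: b i => i; rewrite ?expr1n //.
by case: ifP; rewrite ?sqrrN expr1n.
Qed.

(** Two shifted components coexist only for [Kss], with charges -1 and 1. *)
Lemma charge_inl_neq (i i' : 'I_(nshifted b)) : i != i' ->
  charge Q (inl i : Defs.comp b m) = - charge Q (inl i' : Defs.comp b m).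
Proof.
case: b i i' => i i' /=; rewrite -val_eqE /=;
  have := ltn_ord i; have := ltn_ord i'.
- by [].
- by rewrite /=; lia.
by case: i i' => [[|[|]]] // ? [[|[|]]] // ? _ _ _ /=; rewrite ?opprK.
Qed.

Lemma charge_neq0 (l : Defs.comp b m) : charge Q l != 0.
Proof.
case: l => i; last exact: Q_neq0.
by rewrite -sqrf_eq0 charge_inl_sqr oner_eq0.
Qed.

Lemma separate_of_Poincare_neq0 : Poincare n q Q b != 0 ->
  forall mu : mshape b m, multipart n.+1 mu -> separate q Q mu.
Proof.
case/Poincare_neq0P=> q1 qN1 /Rfactor_neq0P[R1 R2 R3] mu mu_mp t t_std k _.
case=> [[i j] l] [[i' j'] l'] xP yP tx ty.
have {ty} txy : t (i', j', l') = (t (i, j, l)).+1 by rewrite tx.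
rewrite qfun_shift_eq ?charge_neq0 // negb_or.
have qz1 (z : int) : 0 < `|z| < n.+1%:Z -> q ^ (2 * z) != 1.
  by move=> zP; rewrite exprz_even_eq ?expr1n // q1 //; lia.
(* The label [l0] certifies that [b] is not [K0], so that q^(2t) != -1 is available as well. *)
have qe (l0 : 'I_(nshifted b)) (e : K) (z : int) :
    e ^+ 2 = 1 -> 0 < `|z| < n.+1%:Z -> q ^ (2 * z) != e.
  move=> e2 zP; have : (e == 1) || (e == -1) by rewrite -eqf_sqr e2 expr1n.
  case/orP=> /eqP ->; first exact: qz1.
  rewrite exprz_even_eq ?sqrrN ?expr1n // qN1 //.
  by move=> b0; case: l0 => r; rewrite b0.
(* Exchanging u and v preserves the product of charges and turns z into -z in the other factor,
   where the range is symmetric. *)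
have R3' u v (z : int) : u != v -> 1 - n%:Z <= z <= n%:Z - 1 ->
      (Q u != Q v * q ^ (- 2 * z)) && (Q u * Q v != q ^ (- 2 * (z + 1))).
    rewrite -val_eqE; case: (ltngtP u v) => // [uv _ zP | vu _ zP].
      exact: R3.
    have /andP[_ R] := R3 _ _ z vu zP; rewrite [Q u * Q v]mulrC R andbT.
    have /(R3 _ _ _ vu) /andP[+ _]: 1 - n%:Z <= - z <= n%:Z - 1 by lia.
    apply: contraNneq => ->; rewrite -mulrA -expfzDr //.
    by rewrite (_ : - 2 * z + - 2 * - z = 0) ?expr0z ?mulr1 //; ring.
have qX2 (z : int) : (q ^ (2 * z)) ^+ 2 = q ^ (4 * z).
  by rewrite expr2 -expfzDr //; congr (q ^ _); ring.
case: l l' {tx} xP yP txy => u [] v xP yP txy.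
- have [Euv|ne_uv] := eqVneq u v.
    subst v; have [z_bd [s s_bd w_eq]] := consecutive_inl mu_mp t_std xP yP txy.
    rewrite -{1}[charge Q _]mulr1 (inj_eq (mulfI (charge_neq0 _))) eq_sym.
    rewrite qz1 //=.
    rewrite -expr2 charge_inl_sqr mulNr -mulrN.
    apply/eqP => E1; case: w_eq => w_eq; rewrite w_eq in E1.
      by have := @qz1 (- s); rewrite -E1 eqxx => /(_ ltac:(lia)).
    (* When q^(4s) = 1, the power q^(-2s) is itself a square root of 1, so [qe] would make it differ
       from itself. *)
    have := @qe u (q ^ (2 * - s)) (- s); rewrite eqxx qX2 E1.
    by move=> H; apply/negP/H => //; [congr (q ^ _); ring | lia].
  have cP := content_inl_bound mu_mp xP; have c'P := content_inl_bound mu_mp yP.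
  have sz := component_size2_le mu_mp (l := inl u) (l' := inl v) ne_uv.
  apply/andP; split.
    rewrite (charge_inl_neq ne_uv) -mulrN1 (inj_eq (mulfI (charge_neq0 _))).
    rewrite eq_sym.
    (* The charges are opposite, so equal residues mean q^(2z) = -1; for z = 0 this is excluded by
       the characteristic. *)
    set z := _ - _; have [->|z_neq0] := eqVneq z 0.
      by rewrite mulr0 expr0z -subr_eq0 opprK (two_neq0 charK).
    by apply: (qe u); rewrite ?sqrrN ?expr1n //; lia.
  rewrite mulNr -mulrN eq_sym; apply: (qe u); last by lia.
  by rewrite exprMn !charge_inl_sqr mulr1.
- have cP := content_inl_bound mu_mp xP; have c'P := content_inr_bound mu_mp yP.
  have sz := component_size2_le mu_mp (l := inl u) (l' := inr v) isT.
  set z := (j'%:Z - i'%:Z) - _; set w := _ + _ + 1.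
  (* Squaring removes the sign of the shifted charge, so both collisions fall under the second
     product in R. *)
  apply/andP; split; apply/eqP => /(congr1 (fun x => x ^+ 2)) /esym /eqP;
    rewrite exprMn charge_inl_sqr.
    apply/negP; have := R2 v z ltac:(lia); apply: contraNneq => E1; apply/eqP.
    apply: (mulIf (expfz_neq0 (4 * z) q_neq0)); rewrite -qX2 E1 qX2 -expfzDr //.
    by rewrite (_ : - 4 * z + 4 * z = 0) //; ring.
  rewrite mul1r mulNr -mulrN qX2 eq_sym mulrN -mulNr; apply/negP/R2; lia.
- have cP := content_inr_bound mu_mp xP; have c'P := content_inl_bound mu_mp yP.
  have sz := component_size2_le mu_mp (l := inr u) (l' := inl v) isT.
  set z := (j'%:Z - i'%:Z) - _; set w := _ + _ + 1.
  apply/andP; split; apply/eqP => /(congr1 (fun x => x ^+ 2)) /eqP;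
    rewrite exprMn charge_inl_sqr.
    by rewrite mul1r qX2 -[4 * z]mulrNN; apply/negP/R2; lia.
  rewrite mulr1 mulNr -mulrN qX2 mulrN -mulNr; apply/negP/R2; lia.
- have [Euv|ne_uv] := eqVneq u v.
    subst v; have [z_bd w_eq] := consecutive_inr mu_mp t_std xP yP txy.
    rewrite -{1}[charge Q _]mulr1 (inj_eq (mulfI (charge_neq0 _))) eq_sym.
    rewrite qz1 //=.
    (* Incomparable boxes fall under the first product in R, adjacent ones under the second. *)
    rewrite -expr2; case: w_eq => [w_bd|[s s_bd ->]]; first by apply: R1; lia.
    by rewrite mulrA; apply: R2; lia.
  have cP := content_inr_bound mu_mp xP; have c'P := content_inr_bound mu_mp yP.
  have sz := component_size2_le mu_mp (l := inr u) (l' := inr v) ne_uv.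
  (* Here [w] omits the summand 1, since the factor with Q_i Q_i' has exponent -2(t + 1). *)
  rewrite /charge; set z := (j'%:Z - i'%:Z) - _; set w := _ + (j'%:Z - i'%:Z).
  have /andP[_ ->] := R3' u v w ne_uv ltac:(lia); rewrite andbT.
  have /andP[+ _] := R3' u v (- z) ne_uv ltac:(lia).
  by rewrite mulrNN.
Qed.
End Separate.

(** * Standard tableaux built from words *)

Section Words.
Variables (b : kind) (m : nat).

(* The letter (true, l) adds a new row of length 1 to component l, and
   (false, l) adds a box to its first row. Words are read from right to left. *)
Definition letter := (bool * Defs.comp b m)%type.
Implicit Types (la : mshape b m) (a : letter) (w v : seq letter).

(** Shifted components grow only in their first row; the converse uses no other shifted shapes. *)
Definition valid_letter a := if a.2 is inl _ then ~~ a.1 else true.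

Definition add_part (d : bool) (p : seq nat) :=
  if d then rcons p 1%N else (head 0%N p).+1 :: behead p.

Definition add_box la a : mshape b m :=
  [ffun l => if l == a.2 then add_part a.1 (la l) else la l].

Definition new_row la a : nat := if a.1 then size (la a.2) else 0%N.

(** The column needs no shift: a valid letter only touches row 0 of a shifted component, which
    starts in column 0. *)
Definition new_box la a : box b m :=
  (new_row la a, row_len la a.2 (new_row la a), a.2).

Lemma row_len_add la a l r : row_len (add_box la a) l r =
  (row_len la l r + ((l == a.2) && (r == new_row la a)))%N.
Proof.
rewrite /row_len ffunE /new_row; case: eqP => [->|_]; last by rewrite addn0.
case: a.1 => /=; last first.
  by case: (la _) r => [|x p] [|r] /=; rewrite ?nth_nil ?addn0 ?addn1.
by rewrite nth_rcons; case: ltngtP => // [lt_r|gt_r|->];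
  rewrite ?addn0 // nth_default // ltnW.
Qed.

Lemma in_shape_add la a x : valid_letter a ->
  in_shape (add_box la a) x = in_shape la x || (x == new_box la a).
Proof.
case: x => [[i j] l]; rewrite /new_box !xpair_eqE /valid_letter => va.
case: l => l; rewrite ?in_shape_inl ?in_shape_inr row_len_add.
  case: eqP => [E|_]; last by rewrite andbF orbF addn0.
  move: va; rewrite -E /new_row; case: a.1 => //= _.
  by case: (eqVneq i 0%N) => [->|_]; rewrite ?addn0 ?andbF ?orbF //=; lia.
case: eqP => [E|_]; last by rewrite andbF orbF addn0.
rewrite -E /=; case: (eqVneq i (new_row la a)) => [->|_] /=; last first.
  by rewrite addn0 orbF.
by rewrite addn1 ltnS leq_eqVlt orbC andbT.
Qed.

Lemma new_box_notin la a : valid_letter a -> in_shape la (new_box la a) = false.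
Proof.
rewrite /new_box /new_row; case: a => d [l|l] /=; rewrite /valid_letter /=.
  by case: d => //= _; rewrite add0n /row_len ltnn.
by move=> _; rewrite /row_len ltnn.
Qed.

Lemma multipart_add N la a :
  multipart N la -> valid_letter a -> multipart N.+1 (add_box la a).
Proof.
move=> la_mp va; apply/and3P; split.
- apply/forallP => i; have := multipart_inl la_mp i.
  rewrite ffunE; case: eqP => // E; move: va; rewrite /valid_letter -E.
  case: a.1 => //= _; rewrite /is_strict_part; case: (la _) => [|x p] //=.
  by rewrite !inE; case: p => [|y p] //= => /andP[/andP[xy ->] /norP[_ ->]];
    rewrite (ltn_trans xy).
- apply/forallP => i; have := multipart_inr la_mp i.
  rewrite ffunE; case: eqP => // E; rewrite /is_part /add_part => /andP[sp p0].
  case: a.1; last first.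
    case: (la _) sp p0 => [|x p] //=; rewrite !inE.
    by case: p => [|y p] //= => /andP[xy ->] /norP[_ ->]; rewrite ltnW.
  rewrite mem_rcons inE negb_or p0 /= andbT.
  case: (la _) sp p0 => [|x p] //= sp; rewrite rcons_path sp /=.
  by case: last (mem_last x p) => [-> //|y].
- rewrite -(multipart_size la_mp) /shape_size.
  rewrite (bigD1 a.2) //= [in X in _ == X](bigD1 a.2) //= ffunE eqxx.
  rewrite -addSn; apply/eqP; congr (_ + _)%N.
    by case: a.1 => /=; [rewrite sumn_rcons addn1 | case: (la _)].
  by apply: eq_bigr => l /negPf ne_l; rewrite ffunE ne_l.
Qed.

(** Row ends move weakly left going down, so nothing lies weakly below and to the right of the new
    box. Hence it can receive the largest entry. *)
Lemma new_box_max N la a i j i' j' l :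
    multipart N la -> valid_letter a -> new_box la a = (i, j, l) ->
    in_shape la (i', j', l) -> (i <= i')%N -> (j <= j')%N -> False.
Proof.
move=> la_mp va aE yP le_ii' le_jj'.
have := row_len_le la_mp l le_ii'.
case: a va aE => d l0 va [Ei Ej El]; move: Ej yP va; rewrite Ei El.
case: l {El} => l Ej; rewrite ?in_shape_inl ?in_shape_inr => yP va; last by lia.
have i0 : i = 0%N by move: va Ei; rewrite /valid_letter /new_row; case: d.
by have := @row_len_inl _ _ _ _ la_mp l i i' le_ii'; lia.
Qed.

Lemma standard_add N la a t :
    multipart N la -> valid_letter a -> standard la t ->
  standard (add_box la a) (fun x => if x == new_box la a then N.+1 else t x).
Proof.
move=> la_mp va [t_bd t_inj t_surj t_row t_col].
have szN := multipart_size la_mp.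
have lasz := multipart_size (multipart_add la_mp va).
have old x : in_shape la x -> (x == new_box la a) = false.
  by move=> xP; apply/negP => /eqP E; rewrite E new_box_notin in xP.
have t_le x : in_shape la x -> (1 <= t x <= N)%N by rewrite -szN; apply: t_bd.
split.
- move=> x; rewrite lasz in_shape_add //.
  by case: eqP => //= _; rewrite orbF => /t_le; lia.
- move=> x y; rewrite !in_shape_add //; case: eqP => [->|_];
    case: eqP => [->|_] //=; rewrite ?orbF.
  + by move=> _ /t_le; lia.
  + by move=> /t_le; lia.
  + exact: t_inj.
- move=> k; rewrite lasz => kP; have [lt_k|] := ltnP k N.+1.
    have [x xP <-] := t_surj k ltac:(lia).
    by exists x; rewrite ?in_shape_add ?xP // old.
  by exists (new_box la a); rewrite ?in_shape_add ?eqxx ?orbT //; lia.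
- move=> i j j' l; rewrite !in_shape_add //.
  move=> /orP[xP|/eqP xE] /orP[yP|/eqP yE] lt_jj'.
  + by rewrite !old //; apply: t_row.
  + by rewrite (old _ xP) yE eqxx; have := t_le _ xP; lia.
  + by case: (new_box_max la_mp va (esym xE) yP (leqnn i) (ltnW lt_jj')).
  + by move: lt_jj'; have [->] := etrans xE (esym yE); rewrite ltnn.
- move=> i i' j l; rewrite !in_shape_add //.
  move=> /orP[xP|/eqP xE] /orP[yP|/eqP yE] lt_ii'.
  + by rewrite !old //; apply: t_col.
  + by rewrite (old _ xP) yE eqxx; have := t_le _ xP; lia.
  + by case: (new_box_max la_mp va (esym xE) yP (ltnW lt_ii') (leqnn j)).
  + by move: lt_ii'; have [->] := etrans xE (esym yE); rewrite ltnn.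
Qed.

Fixpoint shape_of w : mshape b m :=
  if w is a :: w' then add_box (shape_of w') a else [ffun=> [::]].

(** A box carries the time at which it was added, and 0 stands for positions outside the diagram. *)
Fixpoint tableau_of w (x : box b m) : nat :=
  if w is a :: w' then
    if x == new_box (shape_of w') a then size w else tableau_of w' x
  else 0%N.

Lemma shape_of_cons a w : shape_of (a :: w) = add_box (shape_of w) a.
Proof. by []. Qed.

Lemma tableau_of_cons a w x : tableau_of (a :: w) x =
  if x == new_box (shape_of w) a then (size w).+1 else tableau_of w x.
Proof. by []. Qed.

Lemma shape_of_multipart w :
  all valid_letter w -> multipart (size w) (shape_of w).
Proof.
elim: w => [|a w IHw] /=; last first.
  by case/andP=> va /IHw w_mp; apply: multipart_add.
move=> _; rewrite /multipart /shape_size big1 ?andbT => [|l _]; last first.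
  by rewrite ffunE.
by apply/andP; split; apply/forallP => l; rewrite ffunE.
Qed.

Lemma tableau_of_standard w : all valid_letter w ->
  standard (shape_of w) (tableau_of w).
Proof.
elim: w => [_|a w IHw].
  have nil_shape x : in_shape (shape_of [::]) x = false.
    by case: x => [[i j] [l|l]] /=; rewrite ffunE nth_nil // addn0; lia.
  have nil_size := multipart_size (@shape_of_multipart [::] isT).
  split=> [x|x y|k|i j j' l|i i' j l]; rewrite ?nil_shape //.
  by rewrite nil_size /=; lia.
rewrite /=; case/andP=> va vw.
exact: (standard_add (shape_of_multipart vw) va (IHw vw)).
Qed.

(** Later letters add other boxes only; this allows a word to be padded without disturbing earlier
    entries. *)
Lemma tableau_of_cat v w x : all valid_letter (v ++ w) ->
    in_shape (shape_of w) x ->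
  in_shape (shape_of (v ++ w)) x /\ tableau_of (v ++ w) x = tableau_of w x.
Proof.
elim: v => //= a v IHv /andP[va vvw] xP; have [xP' tx] := IHv vvw xP.
rewrite in_shape_add // xP' tx; split=> //; case: eqP => // E.
by rewrite E new_box_notin in xP'.
Qed.

Lemma shape_of_nseq_neq k d l l' w : l != l' ->
  shape_of (nseq k (d, l') ++ w) l = shape_of w l.
Proof.
by move=> ne_ll'; elim: k => //= k IHk; rewrite ffunE /= (negPf ne_ll').
Qed.

(** The exponent [(0 < k)%N] leaves the component empty for k = 0 instead of giving it a row of
    length 0. *)
Lemma shape_of_nseq_row k l w : shape_of w l = [::] ->
  shape_of (nseq k (false, l) ++ w) l = nseq (0 < k)%N k.
Proof.
move=> w0; elim: k => //= k IHk.
by rewrite ffunE eqxx /= IHk; case: k {IHk}.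
Qed.

Lemma shape_of_nseq_col k l w :
  shape_of (nseq k (true, l) ++ w) l = shape_of w l ++ nseq k 1%N.
Proof.
elim: k => [|k IHk]; first by rewrite cats0.
by rewrite /= ffunE eqxx /= IHk -cats1 -catA -(nseqD k 1) addn1.
Qed.

Lemma eq_new_box la la' d l : la l = la' l ->
  new_box la (d, l) = new_box la' (d, l).
Proof. by rewrite /new_box /new_row /row_len /= => ->. Qed.

End Words.

(** * Nonvanishing from separation *)

Section Converse.
Variables (K : fieldType) (q : K).
Hypotheses (q_neq0 : q != 0) (qDV_neq0 : q + q^-1 != 0).
Hypothesis charK : 2%N \notin [pchar K].
Variables (b : kind) (n m : nat) (Q : 'I_m -> K).
Hypothesis Q_neq0 : forall i, Q i != 0.
Hypothesis sepQ : forall mu : mshape b m, multipart n.+1 mu -> separate q Q mu.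

(** The two boxes receive the entries |w| + 1 and |w| + 2, and the diagram is then completed to n +
    1 boxes. *)
Lemma separate_word (a a' : letter b m) w :
    all (@valid_letter b m) (a' :: a :: w) -> (size w < n)%N ->
  qfun q (residue q Q (new_box (shape_of w) a)) !=
  qfun q (residue q Q (new_box (shape_of (a :: w)) a')).
Proof.
(* The padding prolongs a first row, which is valid in every kind of component. *)
move=> vw sz_w; pose v := nseq (n - (size w).+1) (false, a'.2).
have vall u : all (@valid_letter b m) u -> all (@valid_letter b m) (v ++ u).
  move=> vu; rewrite all_cat vu andbT /v all_nseq /valid_letter /=.
  by case: a'.2; rewrite /= orbT.
pose W := v ++ a' :: a :: w.
have szW : size W = n.+1 by rewrite size_cat size_nseq /= addnS subnK.
have W_mp := shape_of_multipart (vall _ vw); rewrite szW in W_mp.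
have [va' /andP[va vw']] := andP vw.
have xP : in_shape (shape_of (a :: w)) (new_box (shape_of w) a).
  by rewrite shape_of_cons in_shape_add ?eqxx ?orbT.
have xP' : in_shape (shape_of (a' :: a :: w)) (new_box (shape_of w) a).
  by rewrite shape_of_cons in_shape_add // xP.
have yP : in_shape (shape_of (a' :: a :: w)) (new_box (shape_of (a :: w)) a').
  by rewrite shape_of_cons in_shape_add ?eqxx ?orbT.
have [xW tx] := tableau_of_cat (vall _ vw) xP'.
have [yW ty] := tableau_of_cat (vall _ vw) yP.
have W_std := tableau_of_standard (vall _ vw).
apply: (sepQ W_mp W_std (k := (size w).+1) _ xW yW).
- by rewrite (multipart_size W_mp).
- rewrite tx !tableau_of_cons eqxx; case: eqP => // E; move: xP.
  by rewrite E new_box_notin.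
- by rewrite ty tableau_of_cons eqxx.
Qed.

(** This is the content of the box that extends a column ([d] true) or a row of k boxes. *)
Definition signed_length (d : bool) (k : nat) : int := if d then - k%:Z else k.

Lemma residue_nseq d k (l : Defs.comp b m) w : shape_of w l = [::] ->
  residue q Q (new_box (shape_of (nseq k (d, l) ++ w)) (d, l)) =
  charge Q l * q ^ (2 * signed_length d k).
Proof.
move=> w0; rewrite /residue /new_box /new_row /signed_length.
case: d => /=; congr (_ * q ^ (2 * _)).
  rewrite shape_of_nseq_col w0 size_nseq /row_len shape_of_nseq_col w0.
  by rewrite nth_default ?size_nseq // sub0r.
by rewrite /row_len shape_of_nseq_row // subr0; case: k.
Qed.

Lemma separate_line d k (l : Defs.comp b m) :
    valid_letter (d, l) -> (k < n)%N ->
  qfun q (charge Q l * q ^ (2 * signed_length d k)) !=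
  qfun q (charge Q l * q ^ (2 * signed_length d k.+1)).
Proof.
move=> vl lt_kn; have nil0 : shape_of [::] l = [::] by rewrite ffunE.
rewrite -!(residue_nseq _ _ nil0); apply: separate_word.
  by rewrite /= all_cat all_nseq /= vl orbT.
by rewrite size_cat size_nseq addn0.
Qed.

(** Lines of k' and k boxes are built in l' and l; the next two letters extend l and then l'. Growth
    in l does not move the box added to l'. *)
Lemma separate_two_lines d k (l : Defs.comp b m) d' k' (l' : Defs.comp b m) :
    l != l' -> valid_letter (d, l) -> valid_letter (d', l') -> (k + k' < n)%N ->
  qfun q (charge Q l * q ^ (2 * signed_length d k)) !=
  qfun q (charge Q l' * q ^ (2 * signed_length d' k')).
Proof.
move=> ne_ll' vl vl' lt_kn.
have nil0 (l0 : Defs.comp b m) : shape_of [::] l0 = [::] by rewrite ffunE.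
have w0 : shape_of (nseq k' (d', l') ++ [::]) l = [::].
  by rewrite shape_of_nseq_neq.
rewrite -(residue_nseq d k w0) -(residue_nseq d' k' (nil0 l')).
have <- : new_box (shape_of (nseq k.+1 (d, l) ++ nseq k' (d', l') ++ [::]))
    (d', l') = new_box (shape_of (nseq k' (d', l') ++ [::])) (d', l').
  by apply: eq_new_box; rewrite shape_of_nseq_neq // eq_sym.
apply: separate_word.
  by rewrite /= !all_cat !all_nseq /= vl vl' !orbT.
by rewrite !size_cat !size_nseq addn0.
Qed.

(** In a hook with arm a and leg c, the end of the arm, of content a, is filled just before the end
    of the leg, of content -c. *)
Lemma separate_hook a c (l : 'I_m) : (0 < a)%N -> (0 < c)%N -> (a + c <= n)%N ->
  qfun q (Q l * q ^ (2 * a%:Z)) != qfun q (Q l * q ^ (2 * - c%:Z)).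
Proof.
move=> a_gt0 c_gt0 le_acn; pose i : Defs.comp b m := inr l.
pose w := nseq c.-1 (true, i) ++ nseq a (false, i) ++ [::].
have w_i : shape_of w i = a :: nseq c.-1 1%N.
  by rewrite shape_of_nseq_col shape_of_nseq_row ?ffunE // a_gt0.
have aw_i : shape_of ((false, i) :: w) i = a.+1 :: nseq c.-1 1%N.
  by rewrite shape_of_cons ffunE eqxx w_i.
have := @separate_word (false, i) (true, i) w.
rewrite /residue /new_box /new_row /row_len aw_i w_i /= size_nseq prednK //.
rewrite nth_default ?size_nseq ?prednK // subr0 sub0r; apply.
  by rewrite /w !all_cat !all_nseq /= !orbT.
by rewrite /w !size_cat !size_nseq /=; lia.
Qed.

(** The hypothesis [excl] concerns the absence of any component, where separation holds vacuously:
    the assumptions on q give q^2 != 1 and q^4 != 1, but in general not the nonvanishing of later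
    factors. *)
Lemma Poincare_neq0_of_separate : (b = K0 -> m = 0%N -> (n <= 2)%N) ->
  q != 1 -> q != -1 -> Poincare n q Q b != 0.
Proof.
move=> excl q_neq1 q_neqN1.
have neq d k l d' k' l' := qfun_shift_eq q_neq0 qDV_neq0 charK
   (signed_length d k) (signed_length d' k')
   (charge_neq0 (b := b) Q_neq0 l) (charge_neq0 (b := b) Q_neq0 l').
have q2_neq1 : q ^+ 2 != 1 by rewrite -(expr1n K 2) eqf_sqr negb_or q_neq1.
have q2_neqN1 : q ^+ 2 != -1.
  by rewrite -subr_eq0 opprK -(divff q_neq0) expr2 -mulrDr mulf_neq0.
(* Contents t - 1 and t in a shifted row give q^(4t) != 1, which yields both conditions at once. *)
have shifted (i : 'I_(nshifted b)) t : (0 < t <= n)%N ->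
    (q ^+ (2 * t) != 1) && (q ^+ (2 * t) != -1).
  move=> tP; have := @separate_line false t.-1 (inl i) isT ltac:(lia).
  rewrite neq negb_or => /andP[_]; rewrite -expr2 charge_inl_sqr -negb_or.
  rewrite -eqf_sqr expr1n -exprM mulnC eq_sym.
  rewrite (_ : - 2 * _ = 2 * - (2 * t)%N%:Z); last first.
    by rewrite /signed_length; lia.
  by rewrite exprz_even_eq ?expr1n // abszN absz_nat.
have hook (l : 'I_m) a c : (0 < a)%N -> (0 < c)%N -> (a + c <= n)%N ->
    (q ^+ (2 * (a + c)) != 1) && (Q l ^+ 2 != q ^ (- 2 * (a%:Z - c%:Z + 1))).
  move=> a_gt0 c_gt0 le_acn; have := separate_hook l a_gt0 c_gt0 le_acn.
  rewrite (neq false a (inr l) true c (inr l)) negb_or -expr2 /= => /andP[+ ->].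
  rewrite andbT -{1}[Q l]mulr1 (inj_eq (mulfI (Q_neq0 l))) eq_sym.
  rewrite (_ : - c%:Z - a%:Z = - (a + c)%N%:Z); last by lia.
  by rewrite exprz_even_eq ?expr1n // abszN absz_nat.
apply/Poincare_neq0P; split.
- move=> t tP; case E: b excl => excl; last 2 first.
  + by have /andP[] := shifted (cast_ord (esym (congr1 nshifted E)) ord0) t tP.
  + by have /andP[] := shifted (cast_ord (esym (congr1 nshifted E)) ord0) t tP.
  case: (eqVneq t 1%N) => [->|t_neq1]; first by rewrite muln1.
  have [m0|m_gt0] := posnP m.
    have -> : t = 2 by have := excl erefl m0; lia.
    by rewrite (exprM q 2 2) -(expr1n K 2) eqf_sqr negb_or q2_neq1.
  (* The ends of a hook with arm 1 and leg t - 1 have contents differing by t. *)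
  have /andP[] := hook (Ordinal m_gt0) 1%N t.-1 isT ltac:(lia) ltac:(lia).
  by rewrite add1n prednK //; lia.
- move=> b_neq0 t tP; have [i _] : exists i : 'I_(nshifted b), true.
    by case: b b_neq0 => // _; exists ord0.
  by have /andP[] := shifted i t tP.
apply/Rfactor_neq0P; split.
(* Hooks with a - c + 1 = t: arm 1 and leg 2 - t, or arm t and leg 1. The constraint a + c <= n is
   exactly the range of t. *)
- move=> i t tP; have [t_le0|t_gt0] := leP t 0.
    have /andP[_] := hook i 1%N `|2 - t|%N isT ltac:(lia) ltac:(lia).
    by congr (_ != q ^ (_ * _)); lia.
  have /andP[_] := hook i `|t|%N 1%N ltac:(lia) isT ltac:(lia).
  by congr (_ != q ^ (_ * _)); lia.
(* Contents t and t - 1 satisfy c + c' + 1 = 2t; they occur in this order in a column for t <= 0,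
   and in the reverse order in a row for t > 0. *)
- move=> i t tP; have [t_le0|t_gt0] := leP t 0.
    have := @separate_line true `|t|%N (inr i) isT ltac:(lia).
    rewrite neq negb_or => /andP[_]; rewrite -expr2.
    by congr (_ != q ^ _); rewrite /signed_length; lia.
  have := @separate_line false `|t - 1|%N (inr i) isT ltac:(lia).
  rewrite neq negb_or => /andP[_]; rewrite -expr2.
  by congr (_ != q ^ _); rewrite /signed_length; lia.
move=> i i' t lt_ii' tP.
have ne_ii' : (inr i : Defs.comp b m) != inr i'.
  by rewrite (inj_eq (@inr_inj _ _)) -val_eqE neq_ltn lt_ii'.
(* A box of content t in component i against the first box of component i' gives both factors. *)
have := @separate_two_lines (t < 0) `|t|%N (inr i) false 0%N (inr i')
  ne_ii' isT isT ltac:(lia).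
rewrite neq negb_or (_ : signed_length _ `|t| = t); last first.
  by rewrite /signed_length; case: ltP; lia.
by rewrite /= addr0 sub0r mulrN -mulNr.
Qed.
End Converse.

Theorem proposition3p11 (K : closedFieldType) (charK : 2%N \notin [pchar K])
    (n m : nat) (n_gt0 : (1 <= n)%N) (b : kind)
    (excl : b = K0 -> m = 0%N -> (n <= 2)%N)
    (q : K) (q_neq0 : q != 0) (qDV_neq0 : q + q^-1 != 0)
    (q_neq1 : q != 1) (q_neqN1 : q != - 1)
    (Q : 'I_m -> K) (Q_neq0 : forall i, Q i != 0) :
  (forall mu : mshape b m, multipart n.+1 mu -> separate q Q mu)
  <-> Poincare n q Q b != 0.
Proof.
split=> [sepQ | P_neq0 mu mu_mp]; first exact: Poincare_neq0_of_separate.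
exact: separate_of_Poincare_neq0 P_neq0 _ mu_mp.
Qed.
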